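(* $$F_{2\text{-}13}(x,y)=\cfrac{1}{1-\cfrac{x}{1-\cfrac{x}{1-\cfrac{xy}{1-\cfrac{xy}{1-\cfrac{xy^2}{1-\cfrac{xy^2}{1-\ddots}}}}}}},$$ where the successive partial numerators are $x,x,xy,xy,xy^2,xy^2,\dots$, each $xy^i$ ($i\ge 0$) occurring twice.
   Context: An occurrence of the generalized pattern $2\text{-}13$ in $\pi=\pi_1\cdots\pi_n\in S_n$ is a pair of positions $a<b$ with $b+1\le n$ and $\pi_b<\pi_a<\pi_{b+1}$ (the letters playing the roles of 1 and 3 must be adjacent). A permutation is $1\text{-}3\text{-}2$-avoiding if there are no positions $a<b<c$ with $\pi_a<\pi_c<\pi_b$. $f_{\tau;r}(n)$ is the number of $1\text{-}3\text{-}2$-avoiding permutations in $S_n$ containing exactly $r$ occurrences of $\tau$ (with $S_0$ consisting of the empty permutation), and $F_\tau(x,y)=\sum_{n,r\ge 0} f_{\tau;r}(n)x^ny^r$, a formal power series in $x$ with coefficients in $\mathbb Z[y]$. The infinite continued fraction is the $x$-adic limit of its finite truncations. *)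

(* Defs.v *)
From HB Require Import structures.
From mathcomp Require Import all_boot all_order all_algebra all_fingroup.

Set Implicit Arguments.
Unset Strict Implicit.
Unset Printing Implicit Defensive.

Import GRing.Theory.
Local Open Scope ring_scope.

(* Formal power series in one variable x over R, as coefficient sequences. *)
Definition pseries (R : Type) := nat -> R.

Section PowerSeries.
Variable R : comUnitRingType.
Implicit Types s t : pseries R.

Definition ps1 : pseries R := fun n => (n == 0%N)%:R.
Definition ps_sub s t : pseries R := fun n => s n - t n.
Definition ps_mul s t : pseries R :=
  fun n => \sum_(i < n.+1) s i * t (n - i)%N.
(* The series c x. *)
Definition ps_cX (c : R) : pseries R := fun n => if n == 1%N then c else 0.

(* The first n.+1 coefficients of the inverse of s, obtained by solving
   s * t = 1 degree by degree; meaningful only if s 0 is a unit. *)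
Fixpoint ps_inv_prefix s n : seq R :=
  if n is m.+1 then
    let v := ps_inv_prefix s m in
    rcons v (- (s 0%N)^-1 * \sum_(i < m.+1) s i.+1 * v`_(m - i))
  else [:: (s 0%N)^-1].

Definition ps_inv s : pseries R := fun n => (ps_inv_prefix s n)`_n.

(* The truncation of 1 / (1 - a 0 / (1 - a 1 / (1 - ...))) that keeps the
   partial numerators a 0, ..., a K.-1.  When every a i has zero constant
   term, all the denominators have constant term 1. *)
Fixpoint cfrac_trunc (a : nat -> pseries R) (K : nat) : pseries R :=
  if K is K'.+1 then
    ps_inv (ps_sub ps1 (ps_mul (a 0%N) (cfrac_trunc (fun i => a i.+1) K')))
  else ps1.

(* x-adic convergence: u K = s modulo x^N for all large K. *)
Definition xadic_lim (u : nat -> pseries R) s : Prop :=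
  forall N : nat, exists K0 : nat, forall K : nat, (K0 <= K)%N ->
    forall n : nat, (n < N)%N -> u K n = s n.

Lemma size_ps_inv_prefix s n : size (ps_inv_prefix s n) = n.+1.
Proof. by elim: n => //= n IHn; rewrite size_rcons IHn. Qed.

Lemma nth_ps_inv_prefix s n i :
  (i <= n)%N -> (ps_inv_prefix s n)`_i = ps_inv s i.
Proof.
elim: n => [|n IHn]; first by rewrite leqn0 => /eqP ->.
rewrite leq_eqVlt => /predU1P[-> //|lt_in].
by rewrite /= nth_rcons size_ps_inv_prefix lt_in IHn.
Qed.

Lemma ps_mulV s n : s 0%N \is a GRing.unit -> ps_mul s (ps_inv s) n = ps1 n.
Proof.
move=> s0U; rewrite /ps_mul /ps1; case: n => [|n].
  by rewrite big_ord_recl big_ord0 addr0 /= mulrV.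
rewrite big_ord_recl subn0 /= {1}/ps_inv /=.
rewrite nth_rcons size_ps_inv_prefix ltnn eqxx mulrA mulrN mulrV // mulN1r.
apply/eqP; rewrite addrC subr_eq0; apply/eqP; apply: eq_bigr => i _.
by rewrite nth_ps_inv_prefix ?leq_subr.
Qed.

Lemma xadic_lim_unique u s t :
  xadic_lim u s -> xadic_lim u t -> forall n, s n = t n.
Proof.
move=> us ut n; have [K us'] := us n.+1; have [L ut'] := ut n.+1.
by rewrite -(us' (maxn K L)) ?leq_maxl // (ut' (maxn K L)) ?leq_maxr.
Qed.

End PowerSeries.

(* Permutations of {0, ..., n-1} stand for permutations of {1, ..., n}, both as
   positions and as letters; s i is the letter at position i. *)

Definition avoids132 n (s : 'S_n) : bool :=
  ~~ [exists a : 'I_n, exists b : 'I_n, exists c : 'I_n,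
        [&& (a < b)%N, (b < c)%N, (s a < s c)%N & (s c < s b)%N]].

(* The pairs p = (a, b); the witness c is the position b + 1. *)
Definition occurrences_2_13 n (s : 'S_n) : {set 'I_n * 'I_n} :=
  [set p : 'I_n * 'I_n |
     [exists c : 'I_n,
        [&& (p.1 < p.2)%N, c == p.2.+1 :> nat,
            (s p.2 < s p.1)%N & (s p.1 < s c)%N]]].

Definition f_2_13 (r n : nat) : nat :=
  #|[set s : 'S_n | avoids132 s & #|occurrences_2_13 s| == r]|.

(* The coefficient of x^n is the sum over r of f_2_13 r n y^r; the terms with
   r > n^2 vanish (see coef_F_2_13), as there are n^2 pairs of positions.
   Here y is the indeterminate 'X of {poly int}. *)
Definition F_2_13 : pseries {poly int} :=
  fun n => \poly_(r < (n * n).+1) (f_2_13 r n)%:Z.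

Lemma coef_F_2_13 n r : (F_2_13 n)`_r = (f_2_13 r n)%:Z.
Proof.
rewrite coef_poly ltnS; case: leqP => // lt_r.
rewrite /f_2_13; suff ->: [set s : 'S_n | avoids132 s
    & #|occurrences_2_13 s| == r] = set0 by rewrite cards0.
apply/setP => s; rewrite !inE; apply/negP => /andP[_ /eqP er].
have := max_card (mem (occurrences_2_13 s)).
by rewrite er card_prod card_ord leqNgt lt_r.
Qed.

(* Main.v *)
(* A 1-3-2-avoiding permutation of n + 1 letters either starts with its maximum
   n, followed by any 1-3-2-avoider, or factors uniquely as U D l n R with
   U > l > D and l > R.  In the second case U and the pattern of D l R (whose
   maximum is l) are arbitrary 1-3-2-avoiders, the latter nonempty; the
   occurrences of 2-13 are those of U, those of D l R, and one for each letter
   of U, from the ascent l n.  With F n the coefficient of x^n this reads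
     F (n+1) = F n + sum_(a < n) y^a (F a) (F (n - a)).
   Dropping the first two partial numerators substitutes x y for x in the
   continued fraction, so its truncations obey the same recurrence, with the
   factor F a coming from the truncation shorter by two. *)
Require Import Defs.
From mathcomp Require Import all_boot all_order all_algebra all_fingroup.
From mathcomp Require Import zify ring.

Set Implicit Arguments.
Unset Strict Implicit.
Unset Printing Implicit Defensive.

(** * The patterns 1-3-2 and 2-13 in words of natural numbers *)

(** The first letter [x] plays the 1, and then [z] the 3 and [y] the 2: [pairwise] takes the earlier
    letter as first argument. *)
Fixpoint av132 (w : seq nat) : bool :=
  if w is x :: s then pairwise (fun z y => ~~ (x < y < z)) s && av132 s
  else true.

(* The adjacent pairs of s that straddle the letter x; the default 0 of
   head makes the last letter of s count for nothing. *)
Fixpoint straddles (x : nat) (s : seq nat) : nat :=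
  if s is b :: t then (b < x < head 0 t) + straddles x t else 0.

Fixpoint occ213 (w : seq nat) : nat :=
  if w is x :: s then straddles x s + occ213 s else 0.

Lemma pairwise_av132_le x s : all (fun y => y <= x) s ->
  pairwise (fun z y => ~~ (x < y < z)) s.
Proof.
move=> sx; apply/(pairwiseP 0) => i j _ js _.
by have := allP sx _ (mem_nth 0 js) => /=; lia.
Qed.

(** The maximum [m] can only play the 3, so an occurrence not inside [D] or inside [R] has its 1 in
    [D] and its 2 in [R]; conversely, a letter of [D] below one of [R] makes an occurrence with
    [m]. *)
Lemma av132_max m D R : all (fun x => x < m) D -> all (fun x => x < m) R ->
  av132 (D ++ m :: R) = [&& av132 D, av132 R & allrel geq D R].
Proof.
move=> Dm Rm; elim: D Dm => [_|x D IHD /= /andP[xm Dm]].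
  rewrite /= allrel0l andbT; case: av132; rewrite ?andbF // andbT.
  by apply: pairwise_av132_le; apply: sub_all Rm => y /=; lia.
rewrite (IHD Dm) pairwise_cat /= allrel_consl allrel_consr.
have -> : all (fun y => ~~ (x < y < m)) R = all (geq x) R.
  by apply: eq_in_all => y /(allP Rm) /=; lia.
have -> : all (fun z => ~~ (x < m < z)) D.
  by apply/allP => y /(allP Dm) /=; lia.
have [Rx|] := boolP (all (geq x) R); rewrite ?andbF //= ?andbT.
have -> : allrel (fun z y => ~~ (x < y < z)) D R.
  by apply/allrelP => z y _ /(allP Rx) /=; lia.
by rewrite (pairwise_av132_le Rx) /= andbT andbA.
Qed.

(** The 1 is the least letter of an occurrence, so an occurrence that starts in [U] cannot reach
    [V]. *)
Lemma av132_cat_gt U V : allrel (fun u v => v < u) U V ->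
  av132 (U ++ V) = av132 U && av132 V.
Proof.
elim: U => [//|x U IHU]; rewrite allrel_consl => /andP[xV UV] /=.
rewrite (IHU UV) pairwise_cat andbA; congr (_ && _); congr (_ && _).
have -> : allrel (fun z y => ~~ (x < y < z)) U V.
  by apply/allrelP => z y _ /(allP xV) /=; lia.
by rewrite (_ : pairwise _ V) ?andbT //; apply: pairwise_av132_le;
  apply: sub_all xV => y /=; lia.
Qed.

Lemma av132_shift k U : av132 (map (addn k) U) = av132 U.
Proof.
elim: U => //= x U ->; rewrite pairwise_map; congr (_ && _).
by apply: eq_pairwise => z y /=; rewrite !ltn_add2l.
Qed.

(** The defaults make the junction term vanish when [s] or [t] is empty, as [x < x] and [x < 0] both
    fail. *)
Lemma straddles_cat x s t : straddles x (s ++ t) =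
  straddles x s + (last x s < x < head 0 t) + straddles x t.
Proof.
elim: s => [|b s IHs] /=; first by rewrite ltnn.
by rewrite IHs; case: s {IHs} => [|c s] /=; lia.
Qed.

Lemma straddles_lt x s : all (fun y => y < x) s -> straddles x s = 0.
Proof.
elim: s => //= b s IHs /andP[_ sx]; rewrite IHs // addn0.
by case: s sx {IHs} => [|c s] /=; lia.
Qed.

Lemma straddles_shift k x s :
  straddles (k + x) (map (addn k) s) = straddles x s.
Proof.
elim: s => //= b s ->; rewrite ltn_add2l; congr (_ + _).
(* After the last letter the default 0 is not shifted, but nothing is below 0. *)
by case: s => [|c s] /=; rewrite ?ltn_add2l // !ltn0 !andbF.
Qed.

Lemma occ213_shift k U : occ213 (map (addn k) U) = occ213 U.
Proof. by elim: U => //= x U ->; rewrite straddles_shift. Qed.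

(** * Inserting a new maximum after the letter l *)

Section Insert.
Variables (U D R : seq nat) (l n : nat).
Hypotheses (ln : l < n) (Dl : all (fun x => x < l) D).
Hypotheses (Rl : all (fun x => x < l) R) (Ul : all (fun x => l < x < n) U).

(** Cutting at the maximum [n] leaves a prefix U D l, from which U splits off. The conditions that
    remain are those of cutting D l R at its maximum [l], since U and [l] exceed R anyway. *)
Lemma av132_insert :
  av132 (U ++ D ++ l :: n :: R) = av132 U && av132 (D ++ l :: R).
Proof.
have -> : U ++ D ++ l :: n :: R = (U ++ D ++ [:: l]) ++ n :: R.
  by rewrite -!catA.
rewrite av132_max; last first.
- by apply/allP => x /(allP Rl) /=; lia.
- rewrite !all_cat /= andbT ln andbT; apply/andP; split.
    by apply/allP => x /(allP Ul) /=; lia.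
  by apply/allP => x /(allP Dl) /=; lia.
rewrite av132_cat_gt; last first.
  apply/allrelP => u v /(allP Ul) /= ul; rewrite mem_cat inE.
  by case/orP => [/(allP Dl) /=|/eqP ->] /=; lia.
rewrite !av132_max //= allrel0r !andbT !allrel_catl allrel_consl allrel0l.
have -> : allrel geq U R.
  by apply/allrelP => x y /(allP Ul) /= ? /(allP Rl) /= ? /=; lia.
have -> : all (geq l) R by apply/allP => x /(allP Rl) /=; lia.
by case: (av132 U); case: (av132 D); case: (av132 R); rewrite /= ?andbT.
Qed.

(** Each letter x of U gains exactly the ascent from [l] to [n]: the step from U into D l ends below
    x, and so do all steps within D l and within R. *)
Lemma occ213_insert :
  occ213 (U ++ D ++ l :: n :: R) = size U + occ213 U + occ213 (D ++ l :: R).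
Proof.
elim: U Ul => [_|x V IHV /= /andP[xl Vl]]; last first.
  rewrite (IHV Vl) straddles_cat.
  have -> : x < head 0 (D ++ l :: n :: R) = false.
    by case: D Dl => [|d D'] /=; lia.
  have -> : D ++ l :: n :: R = (D ++ [:: l]) ++ n :: R by rewrite -catA.
  rewrite straddles_cat last_cat /= xl.
  have -> : straddles x (D ++ [:: l]) = 0.
    apply: straddles_lt; rewrite all_cat /= andbT; apply/andP; split; last by lia.
    by apply/allP => y /(allP Dl) /=; lia.
  rewrite (@straddles_lt x R); first by lia.
  by apply/allP => y /(allP Rl) /=; lia.
(* For a letter of D, adjacent pairs that start at [l] or [n] start too high, so the insertion of
   [n] changes nothing. *)
rewrite /=; elim: D Dl => [_|x D' IHD /= /andP[xl D'l]].
  rewrite /= !straddles_lt //; first by lia.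
  by apply/allP => y /(allP Rl) /=; lia.
by rewrite (IHD D'l) !straddles_cat /=; lia.
Qed.

End Insert.

(** * Avoiders as words, and gluing two of them *)

Definition avoiders n := [seq w <- permutations (iota 0 n) | av132 w].

Lemma mem_avoiders n w :
  reflect [/\ uniq w, forall x, (x \in w) = (x < n) & av132 w]
          (w \in avoiders n).
Proof.
rewrite mem_filter mem_permutations andbC; apply: (iffP andP) => [[pw aw]|[uw mw aw]].
  split=> //; first by rewrite (perm_uniq pw) iota_uniq.
  by move=> x; rewrite (perm_mem pw) mem_iota.
split=> //; apply: uniq_perm; rewrite ?iota_uniq // => x.
by rewrite mw mem_iota.
Qed.

Lemma avoiders_uniq n : uniq (avoiders n).
Proof. by rewrite filter_uniq ?permutations_uniq. Qed.

(* For s = D l R of size k, with maximum l = k - 1, this is the word U D l n R,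
   where U is shifted above l. *)
Definition glue n k (U s : seq nat) : seq nat :=
  let i := (index k.-1 s).+1 in
  map (addn k) U ++ take i s ++ n :: drop i s.

Lemma glueE n l U D R : l \notin D ->
  glue n l.+1 U (D ++ l :: R) = map (addn l.+1) U ++ D ++ l :: n :: R.
Proof.
move=> lD; rewrite /glue /= index_cat (negbTE lD) /= eqxx addn0.
by rewrite -(size_rcons D l) -(cat_rcons l D R) take_size_cat // drop_size_cat ?cat_rcons.
Qed.

Variant avoider_spec n : seq nat -> Prop :=
  AvoiderSpec (D R : seq nat) of n \notin D & all (fun x => x < n) D &
  all (fun x => x < n) R : avoider_spec n (D ++ n :: R).

Lemma avoiderP n w : w \in avoiders n.+1 -> avoider_spec n w.
Proof.
case/mem_avoiders => uw mw _.
have nw : n \in w by rewrite mw.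
move: uw mw; case/splitPr: nw => D R + mw; rewrite cat_uniq /= negb_or => /and4P[_ /andP[nD _] nR _].
split=> //; apply/allP => x xs.
  have := mw x; rewrite mem_cat xs /= => /esym.
  by have := memPn nD x xs; lia.
have := mw x; rewrite mem_cat inE xs !orbT => /esym.
by have := memPn nR x xs; lia.
Qed.

Lemma size_avoider n w : w \in avoiders n -> size w = n.
Proof.
rewrite mem_filter mem_permutations => /andP[_ /perm_size ->].
exact: size_iota.
Qed.

Lemma avoider_lt n w : w \in avoiders n -> all (fun x => x < n) w.
Proof. by case/mem_avoiders => _ mw _; apply/allP => x; rewrite mw. Qed.

Lemma shift_between n k U : 0 < k -> k <= n -> U \in avoiders (n - k) ->
  all (fun x => k.-1 < x < n) (map (addn k) U).
Proof.
move=> k0 kn /avoider_lt Un; rewrite all_map; apply: sub_all Un => x /=; lia.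
Qed.

Section Glue.
Variables (n k : nat) (U s : seq nat).
Hypotheses (k0 : 0 < k) (kn : k <= n).
Hypotheses (avU : U \in avoiders (n - k)) (avs : s \in avoiders k).

(** The letters fall into three blocks: [s] has those below [k], the shifted [U] those from [k] to
    [n - 1], and [n] stands alone. *)
Lemma glue_avoider : glue n k U s \in avoiders n.+1.
Proof.
have Ul := shift_between k0 kn avU.
case: k k0 kn avU avs Ul => // l _ ln aU as_ Ul.
have Vn := avoider_lt aU; have sl := avoider_lt as_.
have [us ms a_s] := mem_avoiders _ _ as_; have [uU mU a_U] := mem_avoiders _ _ aU.
move: us ms a_s sl; case: (avoiderP as_) => D R lD Dl Rl us ms a_s sl.
rewrite glueE //; have uV : uniq (map (addn l.+1) U).
  by rewrite map_inj_uniq //; exact: addnI.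
have mV x : (x \in map (addn l.+1) U) = (l < x < n).
  apply/idP/idP => [/(allP Ul) //|/andP[lx xn]].
  by rewrite -(subnKC lx) map_f // mU ltn_sub2r // (leq_ltn_trans lx).
have pw : perm_eq (map (addn l.+1) U ++ D ++ l :: n :: R)
                  (n :: map (addn l.+1) U ++ (D ++ l :: R)).
  by apply/seq.permP => p; rewrite /= !count_cat /= !(addnCA _ (p n : nat)).
apply/mem_avoiders; split.
- rewrite (perm_uniq pw) cons_uniq mem_cat negb_or cat_uniq uV us mV ms.
  rewrite ltnn andbF -leqNgt ln !andbT /=; apply/hasPn => x; rewrite ms => xl.
  by rewrite mV negb_and -leqNgt -ltnS xl.
- move=> x; rewrite (perm_mem pw) inE mem_cat ms mV.
  by move: ln; clear; lia.
- by rewrite av132_insert // av132_shift a_U.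
Qed.

Lemma occ213_glue : occ213 (glue n k U s) = n - k + occ213 U + occ213 s.
Proof.
have Ul := shift_between k0 kn avU.
case: k k0 kn avU avs Ul => // l _ ln aU as_ Ul.
case: (avoiderP as_) => D R lD Dl Rl.
by rewrite glueE // occ213_insert // size_map occ213_shift (size_avoider aU).
Qed.

(** The letter just before [n] is l; the letters strictly between l and [n] give back [U], and those
    up to l give back [s]. *)
Definition unglue (w : seq nat) :=
  let l := nth 0 w (index n w).-1 in
  (l.+1, ([seq x - l.+1 | x <- w & l < x < n], [seq x <- w | x <= l])).

Lemma glueK : unglue (glue n k U s) = (k, (U, s)).
Proof.
have Ul := shift_between k0 kn avU.
case: k k0 kn avU avs Ul => // l _ ln aU as_ Ul.
case: (avoiderP as_) => D R lD Dl Rl.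
rewrite glueE // /unglue.
set V := map _ U in Ul *.
have iw : index n (V ++ D ++ l :: n :: R) = (size (V ++ D)).+1.
  rewrite catA -cat_rcons index_cat mem_rcons inE mem_cat /= eqxx addn0.
  case: ifP => [|_]; last by rewrite size_rcons.
  by case/or3P => [/eqP|/(allP Ul)|/(allP Dl)] /=; lia.
rewrite iw /= catA nth_cat ltnn subnn /=.
rewrite !filter_cat /= ltnn leqnn ltnn andbF (leqNgt n) ln /=.
rewrite (all_filterP Ul).
have no s' : all (fun x => x < l) s' -> [seq x <- s' | l < x < n] = [::].
  move=> s'l; apply/eqP; rewrite -(negbK (_ == _)) -has_filter.
  by apply/hasPn => x /(allP s'l) /=; lia.
rewrite !no // !cats0 -map_comp.
have -> : [seq x <- V | x <= l] = [::].
  apply/eqP; rewrite -(negbK (_ == _)) -has_filter.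
  by apply/hasPn => x /(allP Ul) /=; lia.
have yes s' : all (fun x => x < l) s' -> [seq x <- s' | x <= l] = s'.
  by move=> s'l; apply/all_filterP; apply: sub_all s'l => x /=; lia.
rewrite !yes //; congr (_, (_, _)).
by rewrite -[RHS]map_id; apply: eq_map => x /=; rewrite addKn.
Qed.

End Glue.

(** * Decomposing an avoider *)

(** After a letter below [l], a letter above [l] would complete a 1-3-2 with the final [l] as the 2;
    hence all large letters precede all small ones. *)
Lemma av132_rcons_split l s : av132 (rcons s l) -> l \notin s ->
  s = [seq x <- s | l < x] ++ [seq x <- s | x < l].
Proof.
elim: s => //= x s IHs /andP[px avs]; rewrite inE negb_or => /andP[xl ls].
have {}IHs := IHs avs ls; case: (ltngtP x l) xl => [xl _|lx _|] //=; last first.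
  by rewrite -IHs.
have sl : all (fun y => y < l) s.
  apply/allP => y ys; move: px; rewrite -cats1 pairwise_cat allrel_consr.
  case/andP => /andP[/allP /(_ y ys) + _] _; have := memPn ls y ys; lia.
suff -> : [seq x <- s | l < x] = [::].
  by rewrite /= (all_filterP sl).
apply/eqP; rewrite -(negbK (_ == _)) -has_filter.
by apply/hasPn => y /(allP sl) /=; lia.
Qed.

(** Cut at the maximum [n]. If something precedes it, let l be the last such letter: R is below l
    because no letter before [n] is below a letter of R, and the letters before l split into U and
    D. *)
Lemma avoider_cases n w : w \in avoiders n.+1 ->
  (exists2 R, R \in avoiders n & w = n :: R) \/
  exists k U s, [/\ 0 < k, k <= n, U \in avoiders (n - k), s \in avoiders k
                  & w = glue n k U s].
Proof.
move=> aw; have [+ + +] := mem_avoiders _ _ aw.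
case: (avoiderP aw) => {aw} D R nD Dn Rn uw mw.
rewrite av132_max // => /and3P[aD aR DR].
case/lastP: D => [|L l] in nD Dn uw mw aD DR *.
  left; exists R => //; apply/mem_avoiders.
  move: uw => /= /andP[nR uR]; split=> // x.
  have := mw x; rewrite inE; case: eqP => [->|/eqP] /=; last by clear; lia.
  by rewrite ltnn (negbTE nR).
right; exists l.+1.
have [ln Ln] : l < n /\ all (fun x => x < n) L.
  by move: Dn; rewrite all_rcons => /andP.
move: DR uw; rewrite -cats1 allrel_catl allrel_consl allrel0l andbT.
case/andP=> LR lR; rewrite -catA /= cat_uniq /= => /and3P[uL disj].
case/and3P; rewrite inE negb_or => /andP[_ lnR] nR uR.
move: disj; rewrite !negb_or => /and3P[lL nL LRd].
have Rl : all (fun x => x < l) R.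
  by apply/allP => x xR; rewrite /= ltn_neqAle (memPn lnR x xR); exact: (allP lR x xR).
have Ls := av132_rcons_split aD lL.
set V := [seq x <- L | l < x] in Ls; set D := [seq x <- L | x < l] in Ls.
have Vl : all (fun x => l < x < n) V.
  apply/allP => x; rewrite mem_filter => /andP[lx xL].
  by rewrite /= lx; exact: (allP Ln x xL).
have Dl : all (fun x => x < l) D by exact: filter_all.
have Vk : map (addn l.+1) (map (subn^~ l.+1) V) = V.
  rewrite -map_comp -[RHS]map_id; apply/eq_in_map => x /(allP Vl) /andP[lx _].
  exact: subnKC.
have aVDR : av132 V && av132 (D ++ l :: R).
  rewrite -(av132_insert ln Dl Rl Vl) catA -Ls -cat1s catA cats1.
  by rewrite av132_max // ?aD ?aR ?all_rcons ?ln // -cats1 allrel_catl LR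
             allrel_consl lR.
case/andP: aVDR => aV aDR.
have mVD x : x \in L = (x \in V) || (x \in D) by rewrite Ls mem_cat.
exists (map (subn^~ l.+1) V), (D ++ l :: R); split=> //.
- apply/mem_avoiders; split.
  + rewrite map_inj_in_uniq; first exact: filter_uniq.
    by move=> x y /(allP Vl) + /(allP Vl) /=; clear; lia.
  + move=> x; apply/mapP/idP => [[y /(allP Vl) /= + ->]|xn]; first by clear; lia.
    exists (l.+1 + x); last by rewrite addKn.
    rewrite mem_filter; apply/andP; split; first by clear; lia.
    (* This letter is below [n] and above [l], hence not in [R]; so it must lie in [L], and
       therefore in [V]. *)
    have := mw (l.+1 + x); rewrite mem_cat mem_rcons !inE.
    have [-> -> ->] : [/\ (l.+1 + x == l) = false, (l.+1 + x == n) = false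
                         & (l.+1 + x < n.+1) = true].
      by split; move: ln xn; clear; lia.
    suff -> : (l.+1 + x \in R) = false by rewrite !orbF.
    by apply/negP => /(allP Rl) /=; clear; lia.
  + by rewrite -(av132_shift l.+1) Vk.
- apply/mem_avoiders; split=> //.
  + rewrite cat_uniq /= lnR uR filter_uniq // negb_or mem_filter ltnn /= andbT.
    apply/hasPn => x xR; rewrite mem_filter negb_and.
    by rewrite (hasPn LRd x xR) orbT.
  + move=> x; have := mw x; rewrite mem_cat mem_rcons !inE mVD mem_cat inE.
    case: (ltngtP x l) => [xl|xl|->]; last by rewrite !orbT /= => _; rewrite ltnSn.
    * have -> : (x \in V) = false.
        by apply/negP => /(allP Vl) /=; move: xl; clear; lia.
      have [-> -> ->] : [/\ (x == n) = false, (x < n.+1) = true & (x < l.+1) = true].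
        by split; move: xl ln; clear; lia.
      by [].
    * move=> _; rewrite ltnNge xl /=; apply/negbTE; rewrite negb_or.
      apply/andP; split; apply/negP.
        by move/(allP Dl) => /=; move: xl; clear; lia.
      by move/(allP Rl) => /=; move: xl; clear; lia.
- rewrite glueE ?Vk ?catA -?Ls //; last first.
    by apply/negP => /(allP Dl); rewrite /= ltnn.
Qed.

(** The nesting lets a sum over this list split into a sum over [k] of products of two sums. *)
Definition gluings n := [seq (k, p) | k <- iota 1 n,
  p <- [seq (U, s) | U <- avoiders (n - k), s <- avoiders k]].

Lemma gluingsP n k U s : (k, (U, s)) \in gluings n ->
  [/\ 0 < k, k <= n, U \in avoiders (n - k) & s \in avoiders k].
Proof.
case/allpairsPdep => k' [_ [kn /allpairsP[[U' s'] /= [? ? ->]] [-> -> ->]]].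
by move: kn; rewrite mem_iota add1n ltnS => /andP[].
Qed.

(** Both sides are duplicate-free with the same members; the left inverse [unglue] gives injectivity
    and also keeps the two lists on the right disjoint. *)
Lemma perm_avoidersS n : perm_eq (avoiders n.+1)
  ([seq n :: R | R <- avoiders n] ++
   [seq glue n t.1 t.2.1 t.2.2 | t <- gluings n]).
Proof.
apply: uniq_perm; first exact: avoiders_uniq.
  rewrite cat_uniq map_inj_uniq ?avoiders_uniq; last by move=> ? ? [].
  rewrite map_inj_in_uniq /=; last first.
    apply: (can_in_inj (g := unglue n)) => -[k [U s]] /gluingsP[k0 kn aU as_] /=.
    exact: glueK.
  apply/andP; split; last first.
    rewrite allpairs_uniq_dep ?iota_uniq //.
    - move=> k _; apply: allpairs_uniq; rewrite ?avoiders_uniq //.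
      by move=> [? ?] [? ?] _ _ [-> ->].
    - by move=> [? ?] [? ?] _ _ [-> ->].
  apply/hasPn => _ /mapP[[k [U s]] /gluingsP[k0 kn aU as_] ->] /=.
  apply/negP => /mapP[R aR eqR].
  (* On a word starting with [n], the predecessor of index 0 is 0, so [unglue] returns [n.+1], which
     exceeds every admissible [k]. *)
  have := glueK k0 kn aU as_; rewrite eqR /unglue /= eqxx /= ltnn andbF => -[nk].
  by move: kn; rewrite -nk ltnn.
move=> w; rewrite mem_cat; apply/idP/idP.
  case/avoider_cases => [[R aR ->]|[k [U [s [k0 kn aU as_ ->]]]]].
    by rewrite map_f.
  apply/orP; right; apply: (@map_f _ _ _ _ (k, (U, s))).
  apply/allpairsPdep; exists k, (U, s); split=> //.
    by rewrite mem_iota k0 add1n ltnS.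
  by apply/allpairsP; exists (U, s).
case/orP => [/mapP[R aR ->]|/mapP[[k [U s]] /gluingsP[k0 kn aU as_] ->]]; last first.
  exact: glue_avoider.
have [uR mR a_R] := mem_avoiders _ _ aR; apply/mem_avoiders; split.
- by rewrite /= uR mR ltnn.
- by move=> x; rewrite inE mR ltnS [in RHS]leq_eqVlt.
- rewrite /= a_R andbT; apply: pairwise_av132_le.
  by apply/allP => x; rewrite mR => /ltnW.
Qed.

Lemma occ213_max n R : R \in avoiders n -> occ213 (n :: R) = occ213 R.
Proof. by move/avoider_lt=> Rn /=; rewrite straddles_lt. Qed.

(** * From permutations to words *)

Lemma av132P w : reflect
  (forall i j k, i < j -> j < k -> k < size w ->
     ~~ (nth 0 w i < nth 0 w k < nth 0 w j)) (av132 w).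
Proof.
elim: w => [|x s IHs] /=; first by left.
apply: (iffP andP) => [[/(pairwiseP 0) px /IHs avs]|H].
  case=> [|i] [|j] [|k] //= ij jk ks; last exact: avs.
  by apply: px => //; exact: (@ltn_trans k j (size s)).
split; last by apply/IHs => i j k ij jk ks; exact: (H i.+1 j.+1 k.+1).
by apply/(pairwiseP 0) => i j _ js ij; exact: (H 0 i.+1 j.+1).
Qed.

(** At the last position [nth] reads the default 0, which is never above [x], so that term is 0. *)
Lemma straddlesE x s :
  straddles x s = \sum_(i < size s) (nth 0 s i < x < nth 0 s i.+1).
Proof.
elim: s => [|b s IHs] /=; first by rewrite big_ord0.
by rewrite big_ord_recl IHs /= -nth0.
Qed.

Lemma occ213E w : occ213 w = \sum_(i < size w) \sum_(j < size w)
  ((i < j) && (nth 0 w j < nth 0 w i < nth 0 w j.+1)).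
Proof.
elim: w => [|x s IHs] /=; first by rewrite big_ord0.
rewrite big_ord_recl big_ord_recl /= add0n straddlesE IHs; congr (_ + _).
by apply: eq_bigr => i _; rewrite big_ord_recl /= add0n.
Qed.

Section Words.
Variable n : nat.
Implicit Type s : 'S_n.

Definition word s : seq nat := [seq val (s i) | i <- enum 'I_n].

Lemma size_word s : size (word s) = n.
Proof. by rewrite size_map size_enum_ord. Qed.

Lemma nth_word s (i : 'I_n) : nth 0 (word s) i = s i.
Proof. by rewrite (nth_map i) ?size_enum_ord // nth_ord_enum. Qed.

Lemma word_inj : injective word.
Proof.
by move=> s t st; apply/permP => i; apply: val_inj; rewrite /= -!nth_word st.
Qed.

Lemma perm_word s : perm_eq (word s) (iota 0 n).
Proof.
rewrite -val_enum_ord /word map_comp; apply: perm_map.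
apply: uniq_perm; last first; rewrite ?enum_uniq //.
  by move=> i; rewrite mem_enum -(permKV s i) map_f ?mem_enum.
by rewrite map_inj_uniq ?enum_uniq //; exact: perm_inj.
Qed.

(** Words of permutations are distinct rearrangements, and both lists have n! members, so inclusion
    suffices. *)
Lemma perm_words : perm_eq (map word (enum 'S_n)) (permutations (iota 0 n)).
Proof.
have uw : uniq (map word (enum 'S_n)).
  by rewrite map_inj_uniq ?enum_uniq //; exact: word_inj.
apply: uniq_perm; rewrite ?permutations_uniq //.
have sub : {subset map word (enum 'S_n) <= permutations (iota 0 n)}.
  by move=> _ /mapP[s _ ->]; rewrite mem_permutations perm_word.
suff /(uniq_min_size uw sub)[] : size (permutations (iota 0 n)) <=
  size (map word (enum 'S_n)) by [].
by rewrite size_permutations ?iota_uniq // size_map -cardE card_Sn size_iota.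
Qed.

Lemma av132_word s : av132 (word s) = avoids132 s.
Proof.
apply/av132P/idP => [H|].
  apply/negP => /existsP[a /existsP[b /existsP[c /and4P[ab bc ac cb]]]].
  have := H a b c ab bc; rewrite size_word => /(_ (ltn_ord c)).
  by rewrite !nth_word ac cb.
move=> nH i j k ij jk; rewrite size_word => kn.
have jn := ltn_trans jk kn; have in_ := ltn_trans ij jn.
apply: contra nH => /andP[ik kj].
apply/existsP; exists (Ordinal in_); apply/existsP; exists (Ordinal jn).
apply/existsP; exists (Ordinal kn); rewrite /= ij jk.
by rewrite -!nth_word /= ik kj.
Qed.

Lemma occ213_word s : occ213 (word s) = #|occurrences_2_13 s|.
Proof.
rewrite occ213E size_word -sum1_card pair_bigA /= [RHS]big_mkcond /=.
apply: eq_bigr => -[a b] _ /=; rewrite inE /= !nth_word.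
have [ab|_] := boolP (a < b); last by case: existsP => // -[c /and4P[]].
case: existsP => [[c /and4P[_ /eqP <- -> ]]|nH].
  by rewrite nth_word => ->.
case: andP => //= -[_ /andP[ba ab1]]; case: nH.
(* Past the end the letter would read as the default 0, which cannot exceed the letter at [a]. *)
have bn : b.+1 < n.
  rewrite ltnNge; apply/negP => nb.
  by move: ab1; rewrite nth_default ?ltn0 ?size_word.
exists (Ordinal bn); rewrite /= eqxx ba.
by rewrite -(nth_word s (Ordinal bn)).
Qed.

End Words.

Local Open Scope ring_scope.
Import GRing.Theory.

(** * Recurrences for truncated continued fractions *)

Section ContinuedFraction.
Variable R : comUnitRingType.
Implicit Types (s t u : pseries R) (c d : nat -> R).

Let trunc N s : {poly R} := \poly_(i < N.+1) s i.

Lemma coef_trunc_mul N s t n : (n <= N)%N ->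
  (trunc N s * trunc N t)`_n = ps_mul s t n.
Proof.
move=> le_nN; rewrite coefM; apply: eq_bigr => i _.
by rewrite !coef_poly !ltnS (leq_trans _ le_nN) ?leq_ord // (leq_trans (leq_subr _ _)).
Qed.

(** Coefficients up to degree n depend only on truncations at n, so associativity comes from
    polynomials. *)
Lemma ps_mulA s t u n : ps_mul s (ps_mul t u) n = ps_mul (ps_mul s t) u n.
Proof.
have eqL: ps_mul s (ps_mul t u) n = (trunc n s * (trunc n t * trunc n u))`_n.
  rewrite coefM; apply: eq_bigr => i _.
  by rewrite coef_poly ltnS leq_ord coef_trunc_mul ?leq_subr.
rewrite eqL mulrA coefM; apply: eq_bigr => i _.
by rewrite coef_trunc_mul ?leq_ord // coef_poly ltnS leq_subr.
Qed.

Lemma ps_mul_cX x s n :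
  ps_mul (ps_cX x) s n = if n is m.+1 then x * s m else 0.
Proof.
case: n => [|n]; rewrite /ps_mul /ps_cX big_ord_recl mul0r add0r ?big_ord0 //.
rewrite big_ord_recl /= subSS subn0 big1 ?addr0 // => i _.
by rewrite mul0r.
Qed.

Notation cf c K := (cfrac_trunc (fun i => ps_cX (c i)) K).

Lemma cfrac_trunc_0 c K : cf c K 0%N = 1.
Proof.
case: K => [|K] //=; rewrite /ps_inv /= /ps_sub ps_mul_cX /ps1 /=.
by rewrite subr0 invr1.
Qed.

(** With T the tail, V = 1/(1 - c_0 x T) satisfies V = 1 + c_0 x T V; this is its coefficient of
    x^(n+1). *)
Lemma cfrac_trunc_S c K n :
  cf c K.+1 n.+1 = c 0%N * ps_mul (cf (fun i => c i.+1) K) (cf c K.+1) n.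
Proof.
set T := cf (fun i => c i.+1) K.
pose s := ps_sub (ps1 R) (ps_mul (ps_cX (c 0%N)) T).
have s0 : s 0%N = 1 by rewrite /s /ps_sub ps_mul_cX /ps1 subr0.
have := @ps_mulV R s n.+1; rewrite s0 unitr1 => /(_ isT).
rewrite {1}/ps_mul big_ord_recl s0 mul1r subn0 /ps1 /= => /eqP.
rewrite addr_eq0 => /eqP ->; rewrite -sumrN /ps_mul mulr_sumr.
apply: eq_bigr => i _.
by rewrite /s /ps_sub ps_mul_cX /ps1 /= sub0r mulNr opprK mulrA.
Qed.

(** Multiplying every partial numerator by [q] amounts to substituting q x for x. *)
Lemma cfrac_trunc_scale (q : R) c d K n : (forall i, d i = q * c i) ->
  cf d K n = q ^+ n * cf c K n.
Proof.
elim: K c d n => [|K IHK] c d n dE.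
  by rewrite /= /ps1; case: n => [|n]; rewrite ?mulr0 ?expr0 ?mul1r.
(* The truncation recurs in its own recurrence at lower degrees, hence a strong induction on the
   degree inside the one on [K]. *)
have [m] := ubnP n; elim: m n => // m IHm [|n] lt_nm.
  by rewrite !cfrac_trunc_0 expr0 mul1r.
rewrite !cfrac_trunc_S dE /ps_mul !mulr_sumr; apply: eq_bigr => i _.
rewrite (IHK (fun i => c i.+1)) => [|j]; last exact: dE.
rewrite IHm ?(leq_ltn_trans (leq_subr _ _)) //.
by rewrite exprS -[in q ^+ n](subnKC (leq_ord i)) exprD; ring.
Qed.

(** With V = 1 + x G V and G = 1 + x W G one gets V = 1 + x V + x W (V - 1), where W is the
    truncation two shorter with q x for x. The sum stops before a = n since V - 1 has no constant
    term. *)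
Lemma cfrac_trunc_SS (q : R) c K n : (forall i, c i.+2 = q * c i) ->
  c 0%N = 1 -> c 1%N = 1 ->
  cf c K.+2 n.+1 =
    cf c K.+2 n + \sum_(a < n) q ^+ a * cf c K a * cf c K.+2 (n - a)%N.
Proof.
move=> cE c0 c1; rewrite cfrac_trunc_S c0 mul1r.
set G := cf (fun i => c i.+1) K.+1; set V := cf c K.+2.
rewrite {1}/ps_mul big_ord_recl subn0 /G cfrac_trunc_0 mul1r; congr (_ + _).
case: n => [|n]; first by rewrite !big_ord0.
have -> : \sum_(i < n.+1) G (lift ord0 i) * V (n.+1 - lift ord0 i)%N =
          ps_mul (ps_mul (cf (fun i => c i.+2) K) G) V n.
  by apply: eq_bigr => i _; rewrite lift0 /G cfrac_trunc_S c1 mul1r subSS.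
(* Grouping [G] with [V] lets x G V fold back into V - 1. *)
rewrite -ps_mulA; apply: eq_bigr => i _.
rewrite (cfrac_trunc_scale _ _ cE) // -[ps_mul G V _]mul1r -c0 -cfrac_trunc_S.
by rewrite subSn ?leq_ord.
Qed.

End ContinuedFraction.

(** * The recurrence for the generating function, and the conclusion *)

Lemma F_2_13_sum n : F_2_13 n = \sum_(w <- avoiders n) 'X^(occ213 w).
Proof.
rewrite big_filter -(perm_big _ (perm_words n)) big_map big_enum_cond.
apply/polyP => r; rewrite coef_F_2_13 coef_sum /f_2_13 -sum1_card -natz natr_sum.
rewrite big_mkcond [RHS]big_mkcond; apply: eq_bigr => s _.
rewrite inE av132_word occ213_word coefXn eq_sym inE.
by case: avoids132 => //=; case: eqP.
Qed.

Lemma F_2_13_0 : F_2_13 0%N = 1.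
Proof. by rewrite F_2_13_sum /avoiders /= big_seq1 expr0. Qed.

Lemma F_2_13_S n : F_2_13 n.+1 =
  F_2_13 n + \sum_(a < n) 'X^a * F_2_13 a * F_2_13 (n - a)%N.
Proof.
rewrite !F_2_13_sum (perm_big _ (perm_avoidersS n)) big_cat !big_map /=.
congr (_ + _); first by apply: eq_big_seq => R aR; congr 'X^_; exact: occ213_max.
have -> : \sum_(t <- gluings n) 'X^(occ213 (glue n t.1 t.2.1 t.2.2)) =
  \sum_(t <- gluings n) 'X^(n - t.1) * 'X^(occ213 t.2.1) * 'X^(occ213 t.2.2)
  :> {poly int}.
  apply: eq_big_seq => -[k [U s]] /gluingsP[k0 kn aU as_] /=.
  by rewrite occ213_glue // !exprD.
rewrite big_allpairs_dep /=.
transitivity (\sum_(1 <= k < n.+1) 'X^(n - k) * F_2_13 (n - k)%N * F_2_13 k).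
  rewrite /index_iota subn1; apply: eq_bigr => k _.
  rewrite big_allpairs -mulrA !F_2_13_sum big_distrlr mulr_sumr /=.
  by apply: eq_bigr => U _; rewrite mulr_sumr; apply: eq_bigr => s _; rewrite mulrA.
(* Reindex from k, the length of D l R, to a = n - k, the length of U. *)
rewrite big_nat_rev big_add1 /= big_mkord; apply: eq_bigr => a _.
by rewrite add1n !subSS subKn // ltnW.
Qed.

Theorem theorem4p5 :
  xadic_lim
    (cfrac_trunc (fun i : nat => ps_cX ('X^(i./2) : {poly int})))
    F_2_13.
Proof.
(* Each degree costs two partial numerators, because the recurrence calls a truncation shorter by
   two at a smaller degree; so degree n is settled once K is at least 2n. *)
move=> N; exists N.*2 => K leNK n /ltnW le_nN.
have {N leNK le_nN} : (n.*2 <= K)%N by apply: leq_trans leNK; rewrite leq_double.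
have [m] := ubnP n; elim: m n K => // m IHm [|n] K; first by rewrite cfrac_trunc_0 F_2_13_0.
case: K => [|[|K]] // lt_nm; rewrite doubleS !ltnS => le_nK.
have le_nK2 : (n.*2 <= K.+2)%N by rewrite (leq_trans le_nK) // -addn2 leq_addr.
(* Partial numerators two places apart differ by the factor y, so q = y. *)
rewrite (@cfrac_trunc_SS _ 'X) //; last by move=> i; rewrite -exprS.
rewrite F_2_13_S IHm //; congr (_ + _); apply: eq_bigr => a _.
have lt_am : (a < m)%N by exact: ltn_trans (ltn_ord a) lt_nm.
rewrite IHm //; last by rewrite (leq_trans _ le_nK) // leq_double ltnW.
rewrite IHm //; first by rewrite (leq_ltn_trans (leq_subr _ _)).
by rewrite (leq_trans _ le_nK2) // leq_double leq_subr.
Qed.
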